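(* Let $G$ be a connected graph on $n\geq 2$ vertices and let $H$ be a blowup of $G$ with $m$ vertices. Suppose $\sigma$ is a multiset consisting of $n$ distinct real numbers and $\sigma'$ is any multiset of $m-n$ real numbers. Then $\sigma\cup\sigma'$ is the spectrum of some matrix in $\mathcal{S}(H)$.
   Context: For a simple graph $G$ on $n$ vertices, $\mathcal{S}(G)$ is the set of all $n\times n$ real symmetric matrices $A=(a_{ij})$ such that for $i\neq j$, $a_{ij}\neq 0$ if and only if $\{i,j\}$ is an edge of $G$ (diagonal entries unrestricted). For a vertex $v$ and a positive integer $k$, the $k$-duplication of $v$ replaces $v$ by $k$ mutually adjacent vertices, each adjacent to exactly the neighbours of $v$ in $G-v$. If $V(G)=\{v_1,\ldots,v_n\}$ and $m_1,\ldots,m_n$ are positive integers, the blowup of $G$ with respect to $m_1,\ldots,m_n$ is obtained by performing the $m_i$-duplication of $v_i$ for $i=1,\ldots,n$ sequentially; it has $\sum_i m_i$ vertices. *)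

(* Defs.v *)
From HB Require Import structures.
From mathcomp Require Import all_boot all_order all_algebra.
From mathcomp Require Import reals.
Set Implicit Arguments. Unset Strict Implicit. Unset Printing Implicit Defensive.
Import Order.TTheory GRing.Theory Num.Theory.
Local Open Scope ring_scope.

Definition simple_graph (n : nat) (G : rel 'I_n) : Prop :=
  symmetric G /\ irreflexive G.

Definition connected_graph (n : nat) (G : rel 'I_n) : Prop :=
  forall u v : 'I_n, connect G u v.

Definition SG (R : realType) (n : nat) (G : rel 'I_n) (A : 'M[R]_n) : Prop :=
  A^T = A /\ forall i j : 'I_n, i != j -> ((A i j != 0) = G i j).

(* H (on 'I_m) is a blowup of G (on 'I_n): there is a labelling
   f : 'I_m -> 'I_n sending each vertex of H to the vertex of G it duplicates;
   every vertex v_i of G gets m_i = #|f^-1(i)| >= 1 copies (f surjective),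
   copies of the same vertex are mutually adjacent, and copies of distinct
   vertices are adjacent iff the originals are adjacent in G. *)
Definition blowup_of (n m : nat) (G : rel 'I_n) (H : rel 'I_m) : Prop :=
  irreflexive H /\
  exists f : 'I_m -> 'I_n,
    (forall i : 'I_n, exists u : 'I_m, f u = i) /\
    (forall u v : 'I_m, u != v -> H u v = (f u == f v) || G (f u) (f v)).

Definition spectrum_is (R : realType) (n : nat) (A : 'M[R]_n) (s : seq R) : Prop :=
  char_poly A = \prod_(x <- s) ('X - x%:P).

(* Main.v *)
(* For an off-diagonal pattern [X] of the graph and small [e], the fixed-point
   equation [W = e *: eigvec_step W] for the normalised eigenvectors [1 + W]
   produces a diagonal [d] such that [diag d + e X] has any prescribed simple
   spectrum [lam].  Since every vertex has a neighbour, a generic [X] makes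
   [d i] differ from [lam i] at second order while staying close to it, so the
   diagonal can moreover avoid any given finite set [S].
   To duplicate a vertex [u] of a matrix [M] with [M u u != mu], take
   [M (+) mu] and rotate it in the plane of [u] and the new vertex: this adds
   the eigenvalue [mu], gives both copies the neighbours of [u], and joins them
   by an entry proportional to [M u u - mu].  A generic angle keeps the diagonal
   outside [S], so with [S] containing [s'] the step can be iterated. *)
Require Import Defs.
From HB Require Import structures.
From mathcomp Require Import all_boot all_order all_algebra.
From mathcomp Require Import reals.
From mathcomp Require Import ring lra.
From mathcomp Require Import classical_sets functions interval_inference.
From mathcomp Require Import topology normedtype sequences.
Set Implicit Arguments.
Unset Strict Implicit.
Unset Printing Implicit Defensive.
Import Order.TTheory GRing.Theory Num.Theory.
Import numFieldNormedType.Exports.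
Local Open Scope ring_scope.

(** Makes square matrices a complete normed space, as the Banach fixed-point theorem requires. *)
HB.instance Definition _ (R : realType) (n : nat) := Complete.on 'M[R]_n.

(** * Entrywise bounds for the maximum norm of matrices *)

Section MatrixNorm.
Variable R : realType.

Lemma ler_entry_mx_norm (m n : nat) (M : 'M[R]_(m, n)) i j :
  `|M i j| <= `|M|.
Proof.
rewrite [leRHS]/Num.norm /= mx_normrE.
exact: (le_bigmax _ (fun ij : 'I_m * 'I_n => `|M ij.1 ij.2|) (i, j)).
Qed.

Lemma mx_norm_le (m n : nat) (M : 'M[R]_(m, n)) c :
  0 <= c -> (forall i j, `|M i j| <= c) -> `|M| <= c.
Proof.
by move=> c0 Mc; rewrite [leLHS]/Num.norm /= mx_normrE; apply: bigmax_le.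
Qed.

Lemma ler_norm_mulmx (m n p : nat) (M : 'M[R]_(m, n)) (N : 'M[R]_(n, p)) :
  `|M *m N| <= n%:R * `|M| * `|N|.
Proof.
apply: mx_norm_le => [|i j]; first by rewrite ?mulr_ge0.
rewrite mxE (le_trans (ler_norm_sum _ _ _)) //.
have -> : n%:R * `|M| * `|N| = \sum_(k < n) `|M| * `|N|.
  by rewrite sumr_const card_ord -mulrA mulr_natl.
by apply: ler_sum => k _; rewrite normrM ler_pM // ler_entry_mx_norm.
Qed.

End MatrixNorm.

(** * Eigenvectors of a perturbed diagonal matrix by contraction *)

Section Perturbation.
Variables (R : realType) (n : nat) (X : 'M[R]_n) (lam : 'I_n -> R).

(* The diagonal is 0^-1 = 0, so that [eigvec_step] below has zero diagonal. *)
Definition gap_inv : 'M[R]_n := \matrix_(j, i) (lam j - lam i)^-1.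

(* Row [j] of [1 + W] is an eigenvector of [diag d + e X] for [lam j], where
   [d i = lam i - e (W X) i i], if and only if [W = e *: eigvec_step W]. *)
Definition eigvec_step (W : 'M[R]_n) : 'M[R]_n :=
  \matrix_(j, i) ((X j i + (W *m X) j i - W j i * (W *m X) i i) * gap_inv j i).

Let N := n%:R * `|X|.
Let D := `|gap_inv|.

Let N_ge0 : 0 <= N. Proof. by rewrite mulr_ge0. Qed.
Let D_ge0 : 0 <= D. Proof. exact: normr_ge0. Qed.

Let mulX_le (W : 'M[R]_n) i j : `|(W *m X) i j| <= N * `|W|.
Proof.
apply: le_trans (ler_entry_mx_norm _ _ _) _.
by rewrite (le_trans (ler_norm_mulmx _ _)) // mulrAC.
Qed.

(** The quadratic term varies by a product rule, one factor at a time. This leaves three terms, each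
    at most [N * D] times the norm of [V - W] on the unit ball. *)
Lemma eigvec_step_lipschitz (V W : 'M[R]_n) : `|V| <= 1 -> `|W| <= 1 ->
  `|eigvec_step V - eigvec_step W| <= 3 * N * D * `|V - W|.
Proof.
move=> V1 W1; apply: mx_norm_le => [|j i]; first by rewrite !mulr_ge0.
have -> : (eigvec_step V - eigvec_step W) j i =
    (((V - W) *m X) j i - (V - W) j i * (V *m X) i i
      - W j i * ((V - W) *m X) i i) * gap_inv j i.
  have subE (A B : 'M[R]_n) k l : (A - B) k l = A k l - B k l by rewrite !mxE.
  by rewrite mulmxBl !subE ![eigvec_step _ _ _]mxE; ring.
rewrite normrM mulrAC ler_pM ?ler_entry_mx_norm //.
have -> : 3 * N * `|V - W| = N * `|V - W| + `|V - W| * N + 1 * (N * `|V - W|).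
  by ring.
rewrite (le_trans (ler_normB _ _)) // lerD //; last first.
  rewrite normrM ler_pM //.
  exact: le_trans (ler_entry_mx_norm _ _ _) W1.
rewrite (le_trans (ler_normB _ _)) // lerD // normrM ler_pM //.
  exact: ler_entry_mx_norm.
by apply: le_trans (mulX_le _ _ _) _; rewrite ler_piMr.
Qed.

Lemma eigvec_step0 : eigvec_step 0 = \matrix_(j, i) (X j i * gap_inv j i).
Proof.
by apply/matrixP => j i; rewrite mxE mul0mx !mxE mul0r subr0 addr0.
Qed.

Lemma eigvec_step0_norm : `|eigvec_step 0| <= `|X| * D.
Proof.
apply: mx_norm_le => [|j i]; first by rewrite ?mulr_ge0.
by rewrite eigvec_step0 mxE normrM ler_pM ?ler_entry_mx_norm.
Qed.

Let K := (`|X| + 3 * N) * D.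

Let K_ge0 : 0 <= K. Proof. by rewrite mulr_ge0 // addr_ge0 // mulr_ge0. Qed.

Lemma eigvec_step_norm (W : 'M[R]_n) : `|W| <= 1 -> `|eigvec_step W| <= K.
Proof.
move=> W1; rewrite -[eigvec_step W](subrK (eigvec_step 0)).
rewrite (le_trans (ler_normD _ _)) // /K mulrDl addrC lerD ?eigvec_step0_norm //.
rewrite (le_trans (eigvec_step_lipschitz _ _)) ?normr0 // subr0.
by rewrite ler_piMr // !mulr_ge0.
Qed.

(** [K] bounds both the norm and the Lipschitz constant of [eigvec_step] on the unit ball, so
    [e *: eigvec_step] maps this ball to itself and contracts by 1/2. The bound [e * K] records that
    [W] is of first order in [e]. *)
Lemma eigvec_fixpoint (e : R) : 0 < e -> 2 * e * K <= 1 ->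
  exists W : 'M[R]_n,
    [/\ W = e *: eigvec_step W, `|W| <= 1 & `|W| <= e * K].
Proof.
move=> e0 eK.
pose U : set 'M[R]_n := closed_ball 0 1.
have UE (W : 'M[R]_n) : U W <-> `|W| <= 1.
  by rewrite /U closed_ballE // /closed_ball_ /= sub0r normrN.
have normU (W : 'M[R]_n) : `|W| <= 1 -> `|e *: eigvec_step W| <= e * K.
  by move=> W1; rewrite normrZ gtr0_norm // ler_pM2l // eigvec_step_norm.
pose F (W : 'M[R]_n) := e *: eigvec_step W.
have FU : set_fun U U F.
  move=> W /UE W1; apply/UE; rewrite (le_trans (normU _ W1)) //.
  by have := mulr_ge0 (ltW e0) K_ge0; lra.
pose FF : {fun U >-> U} := HB.pack F (isFun.Build _ _ U U F FU).
have ctr : is_contraction FF.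
  exists (2^-1)%:nng; split => /=; first by lra.
  move=> -[V W] /= [/UE V1 /UE W1].
  rewrite /F -scalerBr normrZ gtr0_norm //.
  apply: (@le_trans _ _ (e * (K * `|V - W|))).
    rewrite ler_pM2l // (le_trans (eigvec_step_lipschitz V1 W1)) //.
    by rewrite !ler_wpM2r // lerDr.
  by rewrite mulrA ler_wpM2r //; lra.
have [|W /UE W1 WE] := banach_fixed_point ctr (@closed_ball_closed _ _ _ _).
  by exists 0; apply/UE; rewrite normr0.
by exists W; split => //; rewrite WE; exact: normU.
Qed.

End Perturbation.

(** * Real numbers avoiding finitely many values *)

Section FiniteAvoidance.
Variable R : realType.

Lemma ex_nonroot (p : {poly R}) : p != 0 -> exists2 x, 0 < x & ~~ root p x.
Proof.
move=> p0; pose rs := [seq (k.+1%:R : R) | k <- iota 0 (size p)].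
have : ~~ all (root p) rs.
  apply/negP => rs_roots; have := max_poly_roots p0 rs_roots.
  rewrite size_map size_iota ltnn => /implyP.
  rewrite implybF map_inj_uniq ?iota_uniq // => j k /eqP.
  by rewrite eqr_nat => /eqP[].
by case/allPn => _ /mapP[k _ ->] ?; exists k.+1%:R.
Qed.

Lemma ex_unit_interval_notin (s : seq R) : exists2 x, 0 < x < 1 & x \notin s.
Proof.
pose rs := [seq (k.+2%:R^-1 : R) | k <- iota 0 (size s).+1].
have : ~~ all (mem s) rs.
  apply/negP => /allP /uniq_leq_size; rewrite size_map size_iota ltnn => /implyP.
  rewrite implybF map_inj_uniq ?iota_uniq // => j k /invr_inj /eqP.
  by rewrite eqr_nat => /eqP[].
case/allPn => _ /mapP[k _ ->] ?; exists k.+2%:R^-1 => //.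
by rewrite invr_gt0 ltr0n /= invf_lt1 ?ltr0n // ltr1n.
Qed.

(** Supplies a threshold [g]: a nonzero number of absolute value below [g] differs from every entry
    of [s]. *)
Lemma ex_pos_lower_bound (s : seq R) :
  exists2 g, 0 < g & {in s, forall y, y != 0 -> g <= `|y|}.
Proof.
elim: s => [|y s [g g0 gs]]; first by exists 1.
have [->|y0] := eqVneq y 0.
  by exists g => // z /predU1P[->|/gs//]; rewrite eqxx.
exists (Num.min g `|y|) => [|z]; first by rewrite lt_min g0 normr_gt0.
by case/predU1P => [->|/gs zs /zs gz]; rewrite ge_min ?lexx ?orbT // gz.
Qed.

End FiniteAvoidance.

(** * Realising a simple spectrum with a controlled diagonal *)

Section Simple_spectrum.
Variables (R : realType) (n : nat) (G : rel 'I_n) (lam : 'I_n -> R).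
Hypotheses (Gsym : symmetric G) (Girr : irreflexive G)
  (Gnbr : forall i, exists k, G i k) (lam_inj : injective lam).

(* To second order in [e], the [i]-th diagonal entry of the matrix
   [diag d + e X] with spectrum [lam] is [lam i] minus [e ^+ 2] times this sum. *)
Lemma ex_generic_weights : exists X : 'M[R]_n,
  [/\ X^T = X, forall i, X i i = 0, forall i j, (X i j != 0) = G i j
    & forall i, \sum_k X i k * X k i / (lam i - lam k) != 0].
Proof.
(* With [X i j = t ^+ (i + j)] on edges and [x = t ^+ 2], the sum to be kept nonzero is [x ^+ i * (P
   i).[x]]. A neighbour [k] of [i] gives [P i] a nonzero coefficient, so some positive [x] is a root
   of no [P i]. *)
pose P i : {poly R} := \poly_(k < n)
  (if insub k is Some k' then (G i k')%:R / (lam i - lam k') else 0).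
have PE i x : (P i).[x] = \sum_(k < n) (G i k)%:R / (lam i - lam k) * x ^+ k.
  by rewrite horner_poly; apply: eq_bigr => k _; rewrite valK.
have P0 : \prod_i P i != 0.
  apply/prodf_neq0 => i _; have [k Gik] := Gnbr i.
  apply/negP => /eqP /(congr1 (fun p : {poly R} => p`_k)).
  rewrite coef_poly ltn_ord valK Gik coef0 mul1r => /eqP.
  rewrite invr_eq0 subr_eq0 => /eqP /lam_inj ik.
  by rewrite ik Girr in Gik.
have [x x0 xP] := ex_nonroot P0.
pose t := Num.sqrt x.
have t0 : 0 < t by rewrite sqrtr_gt0.
exists (\matrix_(i, j) ((G i j)%:R * (t ^+ i * t ^+ j))); split.
- by apply/matrixP => i j; rewrite !mxE Gsym [t ^+ j * _]mulrC.
- by move=> i; rewrite mxE Girr mul0r.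
- move=> i j; rewrite mxE mulf_eq0 negb_or pnatr_eq0 eqb0 negbK.
  by rewrite (gt_eqF (mulr_gt0 (exprn_gt0 i t0) (exprn_gt0 j t0))) andbT.
- move=> i; have : (P i).[x] != 0.
    move: xP; rewrite /root horner_prod => /prodf_neq0; exact.
  rewrite PE => Pix.
  rewrite [X in X != 0](_ : _ = x ^+ i *
      \sum_(k < n) (G i k)%:R / (lam i - lam k) * x ^+ k).
    by rewrite mulf_neq0 // gt_eqF ?exprn_gt0.
  rewrite mulr_sumr; apply: eq_bigr => k _; rewrite !mxE (Gsym k i).
  have xE l : x ^+ l = t ^+ l * t ^+ l.
    by rewrite -expr2 exprAC sqr_sqrtr ?ltW.
  rewrite !xE; by case: (G i k); rewrite ?mulr1n ?mulr0n; ring.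
Qed.

(** The rows of [V] are nonzero left eigenvectors, so the monic polynomial of degree [n] has the [n]
    distinct roots [lam i]. *)
Lemma char_poly_eq_prod (A V : 'M[R]_n) :
  (forall i, V i i != 0) ->
  V *m A = diag_mx (\row_i lam i) *m V ->
  char_poly A = \prod_i ('X - (lam i)%:P).
Proof.
move=> V0 VA.
have := @all_roots_prod_XsubC _ (char_poly A) [seq lam i | i <- enum 'I_n].
rewrite size_char_poly size_map size_enum_ord => /(_ erefl).
rewrite (monicP (char_poly_monic A)) scale1r big_map big_enum; apply.
  apply/allP => _ /mapP[i _ ->]; rewrite -eigenvalue_root_char.
  apply/eigenvalueP; exists (row i V); last first.
    apply/eqP => /rowP /(_ i); rewrite !mxE => /eqP.
    by apply/negP.
  by rewrite -row_mul VA mul_diag_mx; apply/rowP => j; rewrite !mxE.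
by rewrite uniq_rootsE map_inj_uniq // enum_uniq.
Qed.

Lemma ex_simple_spectrum (S : seq R) : exists A : 'M[R]_n,
  [/\ SG G A, char_poly A = \prod_i ('X - (lam i)%:P)
    & forall i, A i i \notin S].
Proof.
have [X [Xsym Xdiag XG Xgen]] := ex_generic_weights.
pose L := gap_inv lam; pose N := n%:R * `|X|; pose K := (`|X| + 3 * N) * `|L|.
pose c i := \sum_k X i k * X k i / (lam i - lam k).
pose s1 : seq R := [seq c i | i <- enum 'I_n].
pose s2 : seq R := [seq x - lam i | x <- S, i <- enum 'I_n].
(* [g] bounds from below the second-order coefficients [c i] and the nonzero distances from [lam i]
   to the forbidden values. *)
have [g g0 gP] := ex_pos_lower_bound (s1 ++ s2).
have N0 : 0 <= N by rewrite mulr_ge0.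
have L0 : 0 <= `|L| by exact: normr_ge0.
have K0 : 0 <= K by rewrite mulr_ge0 // addr_ge0 ?normr_ge0 // mulr_ge0.
(* [B] adds up the constants of the later estimates: [2 * K] for the contraction, the product for
   the error in [h i / e], [N] for the shift of the diagonal. The final 1 makes the inequalities
   strict. *)
pose B := 2 * K + N * (3 * N * `|L| * K) + N + 1.
have NL0 : 0 <= 3 * N * `|L| by rewrite !mulr_ge0.
have NK0 : 0 <= N * (3 * N * `|L| * K) by rewrite mulr_ge0 // mulr_ge0.
pose m := Num.min 1 g.
have m0 : 0 < m by rewrite lt_min ltr01.
have B0 : 0 < B by rewrite /B; lra.
pose e := m / B.
have e0 : 0 < e by rewrite divr_gt0.
have eB : e * B = m by rewrite mulfVK // gt_eqF.
have e_small a : a < B -> e * a < m by rewrite -eB ltr_pM2l.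
have m1 : m <= 1 by rewrite ge_min lexx.
have mg : m <= g by rewrite ge_min lexx orbT.
have [|W [WE W1 WK]] := @eigvec_fixpoint R n X lam e e0.
  have : e * (2 * K) < m by apply: e_small; rewrite /B; lra.
  by rewrite -/L -/N -/K; lra.
have addE (A A' : 'M[R]_n) k l : (A + A') k l = A k l + A' k l by rewrite mxE.
have subE (A A' : 'M[R]_n) k l : (A - A') k l = A k l - A' k l by rewrite !mxE.
have sclE (A : 'M[R]_n) k l : (e *: A) k l = e * A k l by rewrite mxE.
pose h i := (W *m X) i i.
have hN i : `|e * h i| < g.
  rewrite normrM gtr0_norm //; apply: lt_le_trans mg.
  apply: (@le_lt_trans _ _ (e * N)); last by apply: e_small; rewrite /B; lra.
  rewrite ler_pM2l // (le_trans (ler_entry_mx_norm _ _ _)) //.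
  by rewrite (le_trans (ler_norm_mulmx _ _)) // mulrAC ler_piMr.
have cg i : g <= `|c i|.
  by apply: gP; [rewrite mem_cat map_f ?mem_enum | exact: Xgen].
(* Replacing [W] by [e *: eigvec_step W] gives [h i] the leading term [e * c i]. The relative error
   [Y *m X] is of order [e], hence smaller than [g], and cannot cancel [c i]. *)
have h0 i : h i != 0.
  pose Y := eigvec_step X lam W - eigvec_step X lam 0.
  have hE : h i = e * (c i + (Y *m X) i i).
    rewrite /h WE -scalemxAl sclE /Y mulmxBl subE.
    have -> : c i = (eigvec_step X lam 0 *m X) i i.
      rewrite mxE; apply: eq_bigr => k _.
      by rewrite eigvec_step0 !mxE mulrAC.
    by rewrite addrC subrK.
  rewrite hE mulf_neq0 ?(gt_eqF e0) //; apply/eqP => cY.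
  have := cg i; rewrite leNgt; case/negP.
  have -> : c i = - (Y *m X) i i by lra.
  rewrite normrN (le_lt_trans (ler_entry_mx_norm _ _ _)) //.
  rewrite (le_lt_trans (ler_norm_mulmx _ _)) // mulrAC -/N.
  apply: lt_le_trans mg.
  apply: (@le_lt_trans _ _ (e * (N * (3 * N * `|L| * K)))); last first.
    by apply: e_small; rewrite /B; lra.
  have Ylip : `|Y| <= 3 * N * `|L| * `|W - 0|.
    by apply: eigvec_step_lipschitz; rewrite ?normr0.
  rewrite [leRHS]mulrCA ler_wpM2l // (le_trans Ylip) //.
  by rewrite subr0 [leRHS]mulrCA ler_wpM2l.
pose d i := lam i - e * h i.
exists (diag_mx (\row_i d i) + e *: X).
have AE i j : (diag_mx (\row_i d i) + e *: X) i j = (d i *+ (i == j)) + e * X i j.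
  by rewrite !mxE.
split.
- split; first by rewrite linearD /= tr_diag_mx linearZ /= Xsym.
  move=> i j ij; rewrite AE (negbTE ij) mulr0n add0r mulf_eq0 negb_or.
  by rewrite XG gt_eqF.
(* Since [gap_inv] vanishes on the diagonal, [1 + W] has unit diagonal and its rows are nonzero. *)
- have W0 i : W i i = 0 by rewrite WE !mxE subrr invr0 mulr0 mulr0.
  apply: (@char_poly_eq_prod _ (1%:M + W)) => [i|].
    by rewrite !mxE W0 addr0 eqxx oner_eq0.
  apply/matrixP => j i.
  rewrite mulmxDl mul1mx !mulmxDr mulmx1 mul_mx_diag -scalemxAr mul_diag_mx.
  have diagE (f : 'I_n -> R) : diag_mx (\row_i f i) j i = f j *+ (j == i).
    by rewrite !mxE.
  rewrite !addE !sclE !diagE; do 4 ?[rewrite [(\matrix_(_, _) _) _ _]mxE].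
  have [->|ji] := eqVneq j i.
    by rewrite Xdiag W0 !mulr1n !mulr0 /d -/(h i); ring.
  (* Off the diagonal, the eigenvector equation is the fixed-point equation multiplied by the
     gap. *)
  have WEji : W j i * (lam j - lam i) =
      e * (X j i + (W *m X) j i - W j i * h i).
    rewrite [in LHS]WE sclE [eigvec_step _ _ _ j i]mxE.
    rewrite [gap_inv _ _ _]mxE -/(h i) -!mulrA mulVf ?mulr1 //.
    by rewrite subr_eq0 (inj_eq lam_inj).
  rewrite !mulr0n /d; lra.
(* The shift [d i - lam i] is nonzero but below [g], whereas a value of [S] distinct from [lam i] is
   at distance at least [g]. *)
- move=> i; rewrite AE eqxx Xdiag mulr0 addr0 mulr1n; apply/negP => dS.
  have : g <= `|d i - lam i|.
    apply: gP; last by rewrite /d addrAC subrr sub0r oppr_eq0 mulf_neq0 // gt_eqF.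
    rewrite mem_cat; apply/orP; right.
    by apply: (@allpairs_f _ _ _ (fun x i => x - lam i)); rewrite ?mem_enum.
  by rewrite /d addrAC subrr sub0r normrN leNgt hN.
Qed.

End Simple_spectrum.

(** * Duplicating a vertex by a plane rotation *)

Section Duplication.
Variable R : realType.

Lemma char_poly_conj (m : nat) (Q Q' M : 'M[R]_m) :
  Q *m Q' = 1%:M -> char_poly (Q *m M *m Q') = char_poly M.
Proof.
move=> QQ'; rewrite /char_poly.
have QQ'P : map_mx polyC Q *m map_mx polyC Q' = 1%:M.
  by rewrite -map_mxM QQ' map_mx1.
have -> : char_poly_mx (Q *m M *m Q') =
    map_mx polyC Q *m char_poly_mx M *m map_mx polyC Q'.
  rewrite /char_poly_mx mulmxBr mulmxBl !map_mxM /=; congr (_ - _).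
  by rewrite scalar_mxC -mulmxA QQ'P mulmx1.
by rewrite !det_mulmx mulrAC -det_mulmx QQ'P det1 mul1r.
Qed.

(** The direct sum of [M] and [mu], with the new coordinate inserted at position [v]. *)
Definition extend_mx (m : nat) (v : 'I_m.+1) (mu : R) (M : 'M[R]_m) :
    'M[R]_m.+1 :=
  \matrix_(i, j) match unlift v i, unlift v j with
    | Some i', Some j' => M i' j'
    | None, None => mu
    | _, _ => 0
    end.

Lemma char_poly_extend_mx (m : nat) (v : 'I_m.+1) mu (M : 'M[R]_m) :
  char_poly (extend_mx v mu M) = ('X - mu%:P) * char_poly M.
Proof.
rewrite /char_poly (expand_det_row _ v) (bigD1 v) //= big1 ?addr0 => [|j jv].
  rewrite !mxE unlift_none eqxx mulr1n /cofactor addnn -signr_odd odd_double.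
  rewrite mul1r; congr (_ * \det _); apply/matrixP => i j.
  by rewrite !mxE !liftK (inj_eq lift_inj).
rewrite !mxE eq_sym (negbTE jv) unlift_none.
by case: unliftP jv => [k -> _|->]; rewrite ?eqxx // subr0 mul0r.
Qed.

(** A Givens rotation, given by rows so that multiplying by it only combines rows [u] and [v]. *)
Definition plane_rotation (m : nat) (u v : 'I_m) (c s : R) : 'M[R]_m :=
  \matrix_i (if i == u then c *: delta_mx 0 u - s *: delta_mx 0 v
             else if i == v then s *: delta_mx 0 u + c *: delta_mx 0 v
             else delta_mx 0 i).

Lemma plane_rotation_mul (m p : nat) (u v : 'I_m) c s (M : 'M[R]_(m, p)) i j :
  (plane_rotation u v c s *m M) i j =
  if i == u then c * M u j - s * M v j
  else if i == v then s * M u j + c * M v j else M i j.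
Proof.
have -> : (plane_rotation u v c s *m M) i j =
    row i (plane_rotation u v c s *m M) 0 j by rewrite [RHS]mxE.
rewrite row_mul rowK; case: eqP => _; [|case: eqP => _].
- by rewrite mulmxBl -!scalemxAl -!rowE !mxE.
- by rewrite mulmxDl -!scalemxAl -!rowE !mxE.
- by rewrite -rowE mxE.
Qed.

Lemma mul_plane_rotation_tr (m p : nat) (u v : 'I_m) c s (M : 'M[R]_(p, m)) i j :
  (M *m (plane_rotation u v c s)^T) i j =
  if j == u then c * M i u - s * M i v
  else if j == v then s * M i u + c * M i v else M i j.
Proof.
have -> : (M *m (plane_rotation u v c s)^T) i j =
    (plane_rotation u v c s *m M^T) j i.
  by rewrite -[M in LHS]trmxK -trmx_mul [LHS]mxE.
by rewrite plane_rotation_mul !mxE.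
Qed.

Lemma plane_rotation_orthogonal (m : nat) (u v : 'I_m) (c s : R) :
  u != v -> c ^+ 2 + s ^+ 2 = 1 ->
  plane_rotation u v c s *m (plane_rotation u v c s)^T = 1%:M.
Proof.
move=> uv cs; apply/matrixP => i j.
have vu : v == u = false by rewrite eq_sym (negbTE uv).
have E k l : plane_rotation u v c s k l =
   if k == u then c * (l == u)%:R - s * (l == v)%:R
   else if k == v then s * (l == u)%:R + c * (l == v)%:R else (l == k)%:R.
  by rewrite !mxE; case: ifP => _; [|case: ifP => _]; rewrite !mxE ?eqxx.
rewrite plane_rotation_mul ![_^T _ _]mxE [1%:M _ _]mxE !E.
have [iu|iu] := eqVneq i u; last have [iv|iv] := eqVneq i v;
  (have [ju|ju] := eqVneq j u; last have [jv|jv] := eqVneq j v);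
  rewrite ?iu ?iv ?ju ?jv ?eqxx ?vu ?(negbTE uv) ?(negbTE iu) ?(negbTE iv)
    ?[u == j]eq_sym ?[v == j]eq_sym ?(negbTE ju) ?(negbTE jv);
  rewrite ?mulr1n ?mulr0n /=; first [ring | by apply: etrans cs; ring].
Qed.

(** The rotation scales the off-diagonal entries of row [u] by [c] for one copy and by [s] for the
    other; both factors are positive, so the adjacency pattern survives. *)
Lemma ex_duplication (m : nat) (H : rel 'I_m.+1) (v : 'I_m.+1) (u : 'I_m)
    (M : 'M[R]_m) (mu : R) (S : seq R) :
  symmetric H -> H v (lift v u) ->
  (forall i, i != u -> H v (lift v i) = H (lift v u) (lift v i)) ->
  SG (relpre (lift v) H) M ->
  M u u != mu -> (forall i, M i i \notin S) ->
  exists A : 'M[R]_m.+1,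
    [/\ SG H A, char_poly A = ('X - mu%:P) * char_poly M
      & forall i, A i i \notin S].
Proof.
move=> Hsym Hvu Hv [Msym MH] Muu MS.
pose a := M u u.
have amu : a - mu != 0 by rewrite subr_eq0.
(* With [x = c ^+ 2], the rotated diagonal entries are [mu + x * (a - mu)] and [a - x * (a - mu)].
   The excluded values of [x] are those putting one of them in [S]. *)
have [x /andP[x0 x1]] := ex_unit_interval_notin
  ([seq (y - mu) / (a - mu) | y <- S] ++ [seq (a - y) / (a - mu) | y <- S]).
rewrite mem_cat negb_or => /andP[xS1 xS2].
have y0 : 0 < 1 - x by rewrite subr_gt0.
pose c := Num.sqrt x; pose s := Num.sqrt (1 - x).
have c0 : 0 < c by rewrite sqrtr_gt0.
have s0 : 0 < s by rewrite sqrtr_gt0.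
have cE : c ^+ 2 = x by rewrite sqr_sqrtr // ltW.
have sE : s ^+ 2 = 1 - x by rewrite sqr_sqrtr // ltW.
have cs : c ^+ 2 + s ^+ 2 = 1 by rewrite cE sE addrC subrK.
pose Q := plane_rotation (lift v u) v c s.
have uv : lift v u != v by rewrite eq_sym neq_lift.
have vu : (v == lift v u) = false by rewrite eq_sym (negbTE uv).
pose A := Q *m extend_mx v mu M *m Q^T.
have AE i j : A i j =
  if j == lift v u then
    c * (Q *m extend_mx v mu M) i (lift v u) - s * (Q *m extend_mx v mu M) i v
  else if j == v then
    s * (Q *m extend_mx v mu M) i (lift v u) + c * (Q *m extend_mx v mu M) i v
  else (Q *m extend_mx v mu M) i j by rewrite mul_plane_rotation_tr.
have EE := (liftK, unlift_none).
have liftE (i : 'I_m) : (lift v i == v) = false by apply/negbTE; rewrite eq_sym neq_lift.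
have Avv : A v v = a - x * (a - mu).
  rewrite AE vu eqxx !plane_rotation_mul vu eqxx !mxE !EE -/a.
  by rewrite !mulr0 addr0 add0r !mulrA -!expr2 cE sE; ring.
have Auu : A (lift v u) (lift v u) = mu + x * (a - mu).
  rewrite AE eqxx !plane_rotation_mul eqxx !mxE !EE -/a.
  by rewrite !mulr0 subr0 sub0r mulrN opprK !mulrA -!expr2 cE sE; ring.
have Auv : A (lift v u) v = c * s * (a - mu).
  by rewrite AE vu eqxx !plane_rotation_mul eqxx !mxE !EE -/a; ring.
have Alift i j : i != u -> j != u -> A (lift v i) (lift v j) = M i j.
  move=> iu ju; rewrite AE !(inj_eq lift_inj) (negbTE ju) liftE.
  rewrite plane_rotation_mul !(inj_eq lift_inj) (negbTE iu) liftE.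
  by rewrite !mxE !EE.
have Aiu i : i != u -> A (lift v i) (lift v u) = c * M i u.
  move=> iu; rewrite AE eqxx !plane_rotation_mul !(inj_eq lift_inj) (negbTE iu) liftE.
  by rewrite !mxE !EE; ring.
have Aiv i : i != u -> A (lift v i) v = s * M i u.
  move=> iu; rewrite AE vu eqxx !plane_rotation_mul !(inj_eq lift_inj) (negbTE iu) liftE.
  by rewrite !mxE !EE; ring.
have Asym : A^T = A.
  rewrite /A !trmx_mul trmxK mulmxA; congr (_ *m _ *m _); apply/matrixP => i j.
  by rewrite !mxE; do 2 case: unlift => // ?; rewrite -[in RHS]Msym mxE.
have AsymE i j : A i j = A j i by rewrite -[in LHS]Asym mxE.
exists A; split.
- split=> //.
  have sw i j : (A i j != 0) = H i j -> (A j i != 0) = H j i.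
    by rewrite AsymE Hsym.
  have MiuH i : i != u -> (M i u != 0) = H (lift v i) (lift v u).
    exact: MH.
  have Pu i : i != u -> (A (lift v i) (lift v u) != 0) = H (lift v i) (lift v u).
    by move=> iu; rewrite Aiu // mulf_eq0 (gt_eqF c0) MiuH.
  have Pv i : (A (lift v i) v != 0) = H (lift v i) v.
    rewrite Hsym; have [->|iu] := eqVneq i u.
      by rewrite Hvu Auv !mulf_neq0 // gt_eqF.
    by rewrite Hv // Aiv // mulf_eq0 (gt_eqF s0) MiuH // Hsym.
  move=> i j; case: (unliftP v i) => [i'|] ->; case: (unliftP v j) => [j'|] -> //.
  + rewrite (inj_eq lift_inj) => ij; have [iu|iu] := eqVneq i' u.
      by rewrite iu; apply/sw/Pu; rewrite -iu eq_sym.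
    have [->|ju] := eqVneq j' u; first exact: Pu.
    by rewrite Alift // MH.
  + by move=> _; apply/sw.
  + by rewrite eqxx.
- rewrite char_poly_conj ?char_poly_extend_mx //.
  exact: plane_rotation_orthogonal.
- move=> i; case: (unliftP v i) => [i'|] ->.
    have [->|iu] := eqVneq i' u; last by rewrite Alift.
    rewrite Auu; apply: contra xS1 => yS.
    by apply/mapP; exists (mu + x * (a - mu)); rewrite // addrAC subrr add0r mulfK.
  rewrite Avv; apply: contra xS2 => yS.
  by apply/mapP; exists (a - x * (a - mu)); rewrite // subKr mulfK.
Qed.

End Duplication.

(** * Building the blowup one vertex at a time *)

Section Blowup.
Variables (R : realType) (n : nat) (G : rel 'I_n) (s S : seq R).
Hypotheses (Gsym : symmetric G) (Girr : irreflexive G)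
  (Gnbr : forall i, exists k, G i k) (size_s : size s = n) (uniq_s : uniq s).

Lemma blowup_sym (m : nat) (H : rel 'I_m) : blowup_of G H -> symmetric H.
Proof.
case=> Hirr [f [_ Hf]] u v; have [-> //|uv] := eqVneq u v.
by rewrite !Hf // 1?eq_sym // Gsym [f v == _]eq_sym.
Qed.

Lemma blowup_same_order_spectrum (H : rel 'I_n) : blowup_of G H ->
  exists A : 'M[R]_n, [/\ SG H A, spectrum_is A s & forall i, A i i \notin S].
Proof.
move=> GH; have Hsym := blowup_sym GH; case: GH => Hirr [f [f_surj Hf]].
(* A section of [f] is an injection of a finite set into itself, hence bijective with inverse [f];
   so [H] is [G] relabelled. *)
have f_inj : injective f.
  have [g gK] := fin_all_exists f_surj.
  have g_inj : injective g := can_inj gK.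
  have [h hK Kh] := injF_bij g_inj.
  have fh : f =1 h by move=> x; rewrite -{1}[x]Kh gK.
  exact: eq_inj (can_inj Kh) (fsym fh).
have HE u v : u != v -> H u v = G (f u) (f v).
  by move=> uv; rewrite Hf // (inj_eq f_inj) (negbTE uv).
pose lam (i : 'I_n) := s`_i.
have lam_inj : injective lam.
  move=> i j /eqP; rewrite nth_uniq ?size_s // => /eqP; exact: val_inj.
have [|A [HA specA AS]] := @ex_simple_spectrum R n H lam Hsym Hirr _ lam_inj S.
  move=> i; have [k Gik] := Gnbr (f i); have [u fu] := f_surj k.
  exists u; rewrite HE ?fu //; apply: contraTneq Gik => iu.
  by rewrite -fu iu Girr.
exists A; split=> //; rewrite /spectrum_is specA.
by rewrite (big_nth 0) size_s big_mkord.
Qed.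

(** Induction on [s']: a vertex [v] with a twin [u] is deleted, and the duplication lemma restores
    it with the eigenvalue [mu]. The set [S] stays fixed throughout. *)
Lemma blowup_spectrum (s' : seq R) (m : nat) (H : rel 'I_m) :
  {subset s' <= S} -> blowup_of G H -> m = (size s' + n)%N ->
  exists A : 'M[R]_m,
    [/\ SG H A, spectrum_is A (s ++ s') & forall i, A i i \notin S].
Proof.
elim: s' m H => [|mu s' IH] m H s'S GH mE.
  by subst m; rewrite cats0; exact: blowup_same_order_spectrum.
rewrite /= addSn in mE; subst m.
have Hsym := blowup_sym GH; have [Hirr [f [f_surj Hf]]] := GH.
(* Pigeonhole: [H] has more vertices than [G]. *)
have [v [u fuv]] : exists v u, f (lift v u) = f v.
  have : ~~ injectiveb f.
    apply/negP => /injectiveP /leq_card.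
    by rewrite !card_ord -addSn leqNgt ltnS leq_addl.
  case/injectivePn => v [w wv fvw]; exists v.
  by case: (unliftP v w) wv fvw => [u ->|->]; [exists u | rewrite eqxx].
pose H' := relpre (lift v) H.
have GH' : blowup_of G H'.
  split=> [i|]; first exact: Hirr.
  exists (f \o lift v); split=> [i|i j ij]; last first.
    by rewrite /H' /= Hf // (inj_eq lift_inj).
  have [w fw] := f_surj i; case: (unliftP v w) => [w' Ew|Ew].
    by exists w'; rewrite /= -Ew.
  (* The twin [u] keeps the fibre of the deleted vertex nonempty. *)
  by exists u; rewrite /= fuv -Ew.
have [|M [HM specM MS]] := IH _ H' _ GH' erefl.
  by move=> x xs'; apply: s'S; rewrite inE xs' orbT.
have vl i : v != lift v i := neq_lift v i.
have [|i iu||A [HA specA AS]] := @ex_duplication R _ H v u M mu S Hsym _ _ HM _ MS.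
- by rewrite Hf // fuv eqxx.
- by rewrite (Hf v) // (Hf (lift v u)) ?fuv // (inj_eq lift_inj) eq_sym.
(* [mu] lies in [S], which the diagonal of [M] avoids. *)
- by apply: contraNneq (MS u) => ->; apply: s'S; rewrite inE eqxx.
exists A; split=> //; rewrite /spectrum_is specA specM.
by rewrite !big_cat /= big_cons mulrCA.
Qed.

End Blowup.

(** The first step of a path to a different vertex reaches a neighbour. *)
Lemma connected_graph_nbr (n : nat) (G : rel 'I_n) :
  (2 <= n)%N -> connected_graph G -> forall i, exists k, G i k.
Proof.
move=> n2 Gconn i.
have [j ji] : exists j, j != i.
  apply/existsP; rewrite -negb_forall; apply/negP => /forallP allE.
  have : (#|'I_n| <= 1)%N.
    by apply/fintype_le1P => j k; move: (allE j) (allE k) => /eqP -> /eqP ->.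
  by rewrite card_ord leqNgt n2.
have /connectP[[|k p] /=] := Gconn i j.
  by move=> _ Ej; rewrite Ej eqxx in ji.
by case/andP => Gik _ _; exists k.
Qed.

Theorem theorem2p5 (R : realType) (n m : nat) (G : rel 'I_n) (H : rel 'I_m)
    (s s' : seq R) :
  (2 <= n)%N ->
  simple_graph G -> connected_graph G ->
  blowup_of G H ->
  size s = n -> uniq s ->
  size s' = (m - n)%N ->
  exists A : 'M[R]_m, SG H A /\ spectrum_is A (s ++ s').
Proof.
move=> n2 [Gsym Girr] Gconn GH size_s uniq_s size_s'.
(* Ensures that the truncated subtraction [m - n] is the true difference. *)
have mn : (n <= m)%N.
  have [_ [f [f_surj _]]] := GH; have [g gK] := fin_all_exists f_surj.
  by have := leq_card g (can_inj gK); rewrite !card_ord.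
have [|A [HA specA _]] := @blowup_spectrum R n G s s' Gsym Girr
  (connected_graph_nbr n2 Gconn) size_s uniq_s s' m H (fun _ => id) GH.
  by rewrite size_s' subnK.
by exists A.
Qed.
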